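(* For every $\varepsilon\in(0,\frac12]$ there exists a non-negative integer $\kappa\in\widetilde O(1/\varepsilon)$ such that for every protocol $\Pi=(\mathsf A,\mathsf B)$, either $\mathrm{val}(\mathsf A^{(\kappa)}_\Pi,\mathsf B)>1-\varepsilon$ or $\mathrm{val}(\mathsf A,\mathsf B^{(\kappa)}_\Pi)<\varepsilon$.
   Context: An $m$-round protocol $\Pi=(\mathsf A,\mathsf B)$ (no inputs, single-bit messages, parties possibly computationally unbounded) is identified with the complete binary tree of height $m$: nodes are binary strings of length at most $m$, the root is the empty string $\lambda$, the children of $u$ are $u0,u1$, and leaves are strings of length $m$. A control scheme assigns each non-leaf node to the party sending the next bit; $e_\Pi(u,ub)$ is the probability that the next bit is $b$ given transcript $u$; $\chi_\Pi$ maps each leaf to the parties' common output in $\{0,1\}$; $L_\Pi$ is the distribution of the leaf reached in a random execution, and $\mathrm{val}(\Pi)=\mathbb E_{\ell\leftarrow L_\Pi}[\chi_\Pi(\ell)]$. Recursive biased-continuation attackers: $\mathsf A^{(0)}_\Pi=\mathsf A$; for $i>0$, $\mathsf A^{(i)}_\Pi$ on an $\mathsf A$-controlled transcript $u$ samples a leaf $\ell\leftarrow L_{(\mathsf A^{(i-1)}_\Pi,\mathsf B)}$ conditioned on $\ell$ having prefix $u$ and $\chi_\Pi(\ell)=1$ (if no such leaf has positive probability, an arbitrary leaf extending $u$), and sends $\ell_{|u|+1}$; at a leaf it outputs $\chi_\Pi$ of that leaf. Analogously $\mathsf B^{(0)}_\Pi=\mathsf B$ and $\mathsf B^{(i)}_\Pi$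 on $\mathsf B$-controlled $u$ samples $\ell\leftarrow L_{(\mathsf A,\mathsf B^{(i-1)}_\Pi)}$ conditioned on prefix $u$ and $\chi_\Pi(\ell)=0$, and sends $\ell_{|u|+1}$. $\mathrm{val}(\mathsf A',\mathsf B')$ denotes the value of the protocol in which $\mathsf A',\mathsf B'$ take the roles of $\mathsf A,\mathsf B$ (same control scheme and output function). *)

(* Defs.v *)
From mathcomp Require Import all_boot all_order all_algebra.
From mathcomp Require Import reals exp.
Set Implicit Arguments. Unset Strict Implicit. Unset Printing Implicit Defensive.
Import Order.TTheory GRing.Theory Num.Theory.
Local Open Scope ring_scope.

(* An m-round protocol is given by
   - [ctrl : seq bool -> bool] : control scheme; [ctrl u = true] iff A sends the
     next bit at the (non-leaf) node u, otherwise B does;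
   - [e : seq bool -> R] : e u = e_Pi(u, u1), the probability that the next bit is 1
     given transcript u (so e_Pi(u,u0) = 1 - e u);
   - [chi : seq bool -> bool] : the common output at a leaf (true = 1).
   Nodes are binary strings (seq bool), leaves are strings of length m.

   A (possibly attacking) behaviour of a party is a "next-bit" function
   [s : seq bool -> R], s u = probability of sending 1 at u.  When A plays [sA]
   and B plays [sB], the next bit at u is drawn by [joint ctrl sA sB u]. *)

Section Protocols.
Variable R : realType.

Definition joint (ctrl : seq bool -> bool) (sA sB : seq bool -> R) (u : seq bool) : R :=
  if ctrl u then sA u else sB u.

Definition pathprob (q : seq bool -> R) (u : seq bool) : R :=
  \prod_(i < size u) (if nth false u i then q (take i u) else 1 - q (take i u)).

Definition massb (m : nat) (chi : seq bool -> bool) (b : bool)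
    (q : seq bool -> R) (u : seq bool) : R :=
  \sum_(t : m.-tuple bool | prefix u t && (chi t == b)) pathprob q t.

Definition pval (m : nat) (chi : seq bool -> bool) (q : seq bool -> R) : R :=
  \sum_(t : m.-tuple bool | chi t) pathprob q t.

(* Biased continuation step: given the current joint next-bit function q, at
   node u, sample a leaf l <- L_q conditioned on prefix u and chi l = b, and send
   l_{|u|+1}.  If no such leaf has positive probability, the arbitrary leaf is
   modelled by the arbitrary fallback bit [fb u]. *)
Definition bc_step (m : nat) (chi : seq bool -> bool) (b : bool)
    (q : seq bool -> R) (fb : seq bool -> bool) (u : seq bool) : R :=
  let den := massb m chi b q u in
  if 0 < den then massb m chi b q (rcons u true) / den
  else (if fb u then 1 else 0).

(* A^{(i)}_Pi ; [fA i] resolves the arbitrary choice made by A^{(i+1)} *)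
Fixpoint attA (m : nat) (ctrl : seq bool -> bool) (e : seq bool -> R)
    (chi : seq bool -> bool) (fA : nat -> seq bool -> bool) (i : nat) : seq bool -> R :=
  match i with
  | 0 => e
  | i'.+1 => bc_step m chi true (joint ctrl (attA m ctrl e chi fA i') e) (fA i')
  end.

Fixpoint attB (m : nat) (ctrl : seq bool -> bool) (e : seq bool -> R)
    (chi : seq bool -> bool) (fB : nat -> seq bool -> bool) (i : nat) : seq bool -> R :=
  match i with
  | 0 => e
  | i'.+1 => bc_step m chi false (joint ctrl e (attB m ctrl e chi fB i')) (fB i')
  end.

End Protocols.

(* Main.v *)
Require Import Defs.
From mathcomp Require Import all_boot all_order all_algebra.
From mathcomp Require Import polyrcf boolp reals sequences exp ring lra zify.
Set Implicit Arguments. Unset Strict Implicit. Unset Printing Implicit Defensive.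
Import Order.TTheory GRing.Theory Num.Theory.
Local Open Scope ring_scope.

(** Let [V_i u] be the value from node [u] of the protocol attacked by
    [A^(i)], and [T u = V_0 u * ... * V_n u].  Since [A^(i+1)] reweights an edge
    by [V_i child / V_i u], the product telescopes: at nodes of [A], [T u] is
    exactly the honest average of [T] over the children.  At nodes of [B] every
    [V_i] is averaged, so by Hölder [T^(1/(n+1))] is at least the average over
    the children.  The same holds, with the roles exchanged, for the product [S]
    of the probabilities of outcome 0 under [B^(0)], ..., [B^(n)].  Hence it is
    enough to find a set of pairs [(x, y)] containing [(0, 1)] and [(1, 0)] and
    closed under averaging one coordinate while taking [(n+1)]-power means of
    the other, and to bound it away from the origin.  The set [region] below
    meets the diagonal at [x = y = (n+2)^(-1/(n+1))], so one of [T] and [S] is at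
    least [1/(n+2)] at the root.  As [V_i] is nondecreasing in [i], failure of
    both attacks would give [1/(n+2) <= (1 - eps)^(n+1)], which is false once [n]
    is about [(4/eps) ln (1/eps)]. *)

(** * Power and Hölder inequalities *)

Lemma nth_root_exists (R : realType) (n : nat) (y : R) :
  0 <= y -> exists2 r : R, 0 <= r & r ^+ n.+1 = y.
Proof.
move=> y0; exists (y `^ (n.+1%:R^-1)); first exact: powR_ge0.
by rewrite -powR_mulrn ?powR_ge0// -powRrM mulVf ?pnatr_eq0// powRr1.
Qed.

(** Convexity of powers: multiplying the previous case by [b] leaves the defect
    [n.+1%:R * a ^+ n * (b - a) ^+ 2]. *)
Lemma bernoulli_tangent (R : realDomainType) (n : nat) (a b : R) :
  0 <= a -> 0 <= b -> a ^+ n.+1 + n.+1%:R * a ^+ n * (b - a) <= b ^+ n.+1.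
Proof.
move=> a0 b0; elim: n => [|n IH]; first by rewrite !expr1 expr0; lra.
rewrite (exprS b); apply: le_trans (ler_wpM2l b0 IH).
have H : 0 <= n.+1%:R * a ^+ n * (b - a) ^+ 2.
  by rewrite mulr_ge0 ?sqr_ge0// mulr_ge0 ?exprn_ge0.
rewrite -subr_ge0 (_ : _ - _ = n.+1%:R * a ^+ n * (b - a) ^+ 2)//.
by rewrite -(natr1 n.+1) !exprS; ring.
Qed.

(** Normalise the factors by their averages [D i] and apply AM-GM to the [a i / D i] and to the
    [b i / D i]; the weighted sum of the two arithmetic means is 1. *)
Lemma holder2 (R : realType) (n : nat) (p x1 x2 : R) (a b : nat -> R) :
  0 <= p <= 1 -> 0 <= x1 -> 0 <= x2 ->
  (forall i, 0 <= a i) -> (forall i, 0 <= b i) ->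
  x1 ^+ n.+1 <= \prod_(i < n.+1) a i -> x2 ^+ n.+1 <= \prod_(i < n.+1) b i ->
  (p * x1 + (1 - p) * x2) ^+ n.+1
    <= \prod_(i < n.+1) (p * a i + (1 - p) * b i).
Proof.
move=> /andP[p0 p1] x10 x20 a0 b0 h1 h2.
pose D i := p * a i + (1 - p) * b i.
have q0 : 0 <= 1 - p by lra.
have D0 i : 0 <= D i by rewrite addr_ge0// mulr_ge0.
(* If some [D i] is 0, each of the two terms has weight zero or a zero factor, so the left side
   vanishes. *)
have [/existsP[i /eqP Di]|/existsPn Dn] := boolP [exists i : 'I_n.+1, D i == 0].
  suff -> : p * x1 + (1 - p) * x2 = 0.
    by rewrite expr0n; apply: prodr_ge0 => j _; exact: D0.
  have [pa qb] : p * a i = 0 /\ (1 - p) * b i = 0.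
    have := mulr_ge0 p0 (a0 i); have := mulr_ge0 q0 (b0 i).
    by move: Di; rewrite /D; lra.
  have vanish (r x : R) (c : nat -> R) : x ^+ n.+1 <= \prod_(j < n.+1) c j ->
      0 <= x -> r * c i = 0 -> r * x = 0.
    move=> h x0 /eqP; rewrite mulf_eq0 => /orP[/eqP->|/eqP ci]; first by rewrite mul0r.
    move: h; rewrite (bigD1 i)//= ci mul0r => h.
    have /eqP : x ^+ n.+1 = 0 by apply/eqP; rewrite eq_le h exprn_ge0.
    by rewrite expf_eq0 => /andP[_ /eqP->]; rewrite mulr0.
  by rewrite (vanish _ _ _ h1)// (vanish _ _ _ h2)// addr0.
have Dp (i : 'I_n.+1) : 0 < D i by rewrite lt_neqAle D0 eq_sym Dn.
have [d d0 dE] : exists2 d : R, 0 <= d & d ^+ n.+1 = \prod_(i < n.+1) D i.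
  by apply: nth_root_exists; apply: prodr_ge0.
have dp : 0 < d.
  have : 0 < d ^+ n.+1 by rewrite dE; apply: prodr_gt0.
  move=> dn; rewrite lt_neqAle d0 andbT.
  by apply: contraTneq dn => <-; rewrite expr0n ltxx.
have avg (x : R) (c : nat -> R) : 0 <= x -> (forall i, 0 <= c i) ->
    x ^+ n.+1 <= \prod_(i < n.+1) c i ->
    x / d <= (\sum_(i < n.+1) c i / D i) / n.+1%:R.
  move=> x0 c0 h.
  have E0 (i : 'I_n.+1) : 0 <= c i / D i by rewrite divr_ge0.
  have /= := leif_AGM (A := 'I_n.+1) (E := fun i : 'I_n.+1 => c i / D i)
    (fun i _ => E0 i).
  rewrite card_ord => -[H _].
  rewrite -(@ler_pXn2r _ n.+1)// ?nnegrE ?divr_ge0 ?sumr_ge0//.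
  apply: le_trans H; rewrite prodf_div expr_div_n dE.
  by rewrite ler_wpM2r// invr_ge0 prodr_ge0.
rewrite -/(D _) (eq_bigr (fun i : 'I_n.+1 => D i))// -dE.
rewrite lerXn2r ?nnegrE ?addr_ge0 ?mulr_ge0//.
rewrite -[leRHS]mul1r -ler_pdivrMr//.
have -> : (p * x1 + (1 - p) * x2) / d = p * (x1 / d) + (1 - p) * (x2 / d).
  by rewrite mulrDl !mulrA.
apply: le_trans (lerD (ler_wpM2l p0 (avg _ _ x10 a0 h1))
  (ler_wpM2l q0 (avg _ _ x20 b0 h2))) _.
rewrite !mulrA -mulrDl !mulr_sumr -big_split /=.
rewrite (eq_bigr (fun=> 1)) => [|i _]; last first.
  by rewrite !mulrA -mulrDl -/(D i) divff// gt_eqF ?Dp.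
by rewrite sumr_const card_ord divff// pnatr_eq0.
Qed.

(* The boundary of [region] crosses the diagonal at [(tpt, tpt)].  Taking [tpt^(n+1)
  = 1/(n+2)]
   makes the two arcs of its boundary meet with equal slopes there, and puts
   the inflection point of [(1 - x^(n+1))^(n+1)] exactly at [tpt]. *)
Definition tau {R : realType} (n : nat) : R := n.+2%:R^-1.
Definition tpt {R : realType} (n : nat) : R := tau n `^ (n.+1%:R^-1).
Definition slope {R : realType} (n : nat) : R := (1 - tau n) / tpt n.

(** * Geometry of the invariant region *)

Section Region.
Variables (R : realType) (n : nat).
Local Notation tau := (@tau R n).
Local Notation t := (@tpt R n).
Local Notation s := (@slope R n).

Lemma tau_gt0 : 0 < tau. Proof. by rewrite invr_gt0. Qed.

Lemma tau_mass : n.+1%:R * tau = 1 - tau.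
Proof.
have : n.+2%:R * tau = 1 by rewrite divff// pnatr_eq0.
by rewrite -(natr1 n.+1); lra.
Qed.

Lemma tpt_gt0 : 0 < t. Proof. by rewrite powR_gt0 ?tau_gt0. Qed.

Lemma tptX : t ^+ n.+1 = tau.
Proof.
by rewrite -powR_mulrn ?powR_ge0// -powRrM mulVf ?pnatr_eq0// powRr1// ltW ?tau_gt0.
Qed.

Lemma tau_lt1 : tau < 1.
Proof. by rewrite invf_lt1// ltr1n. Qed.

Lemma tpt_lt1 : t < 1.
Proof. by rewrite -(@ltr_pXn2r _ n.+1)// ?nnegrE ?(ltW tpt_gt0)// tptX expr1n tau_lt1. Qed.

Lemma slope_gt0 : 0 < s.
Proof. by rewrite divr_gt0 ?tpt_gt0// subr_gt0 tau_lt1. Qed.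

Lemma slope_tpt : s * t = 1 - tau.
Proof. by rewrite divfK// gt_eqF// tpt_gt0. Qed.

Lemma slopeX : s ^+ n.+1 * tau = (1 - tau) ^+ n.+1.
Proof. by rewrite -slope_tpt (exprMn _ s t) tptX. Qed.

(** This puts [(0, 1)] in [region]. Bernoulli at 1 gives [(1 - tau) ^+ n.+1 >= 1 - n.+1%:R * tau =
    tau]. *)
Lemma slope_ge1 : 1 <= s.
Proof.
rewrite -(@ler_pXn2r _ n.+1)// ?nnegrE ?(ltW slope_gt0)// expr1n.
rewrite -(ler_pM2r tau_gt0) mul1r slopeX.
have := @bernoulli_tangent R n 1 (1 - tau) ler01.
rewrite !expr1n mulr1 subr_ge0 => /(_ (ltW tau_lt1)).
have -> : 1 - tau - 1 = - tau by ring.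
rewrite mulrN tau_mass; lra.
Qed.

(** The derivative [1 - n.+2%:R * a ^+ n.+1] is nonpositive from [t] on, since [t ^+ n.+1] is
    [1 / n.+2]. *)
Lemma hump_le (a b : R) : t <= a -> a <= b -> b * (1 - b ^+ n.+1) <= a * (1 - a ^+ n.+1).
Proof.
move=> ta ab; have a0 : 0 <= a by apply: le_trans ta; exact: ltW tpt_gt0.
have := @bernoulli_tangent R n.+1 a b a0 (le_trans a0 ab).
have : 1 <= n.+2%:R * a ^+ n.+1.
  apply: (@le_trans _ _ (n.+2%:R * tau)); first by rewrite divff// pnatr_eq0.
  by rewrite ler_wpM2l// -tptX lerXn2r// nnegrE// ltW ?tpt_gt0.
move=> /(ler_wpM2r (_ : 0 <= b - a)); rewrite subr_ge0 => /(_ ab).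
by rewrite !(exprS _ n.+1); lra.
Qed.

Lemma hump_max (x : R) : 0 <= x -> x * (1 - x ^+ n.+1) <= t * (1 - tau).
Proof.
move=> x0; have := @bernoulli_tangent R n.+1 t x (ltW tpt_gt0) x0.
rewrite !(exprS _ n.+1) tptX -mulrA (mulrA n.+2%:R) divff ?pnatr_eq0//; lra.
Qed.

(** On the arc [1 = x ^+ n.+1 + s * y], [F x] is [(s * y) ^+ n.+1]; [dF] is minus the derivative of
    [F]. *)
Local Notation F x := ((1 - x ^+ n.+1) ^+ n.+1).
Local Notation dF x := (n.+1%:R ^+ 2 * (x * (1 - x ^+ n.+1)) ^+ n).

Lemma F_mvt (a b : R) : a < b ->
  exists2 c, a < c < b & F b - F a = - dF c * (b - a).
Proof.
move=> ab; have [c cab] := mvt ((1 - 'X ^+ n.+1 : {poly R}) ^+ n.+1) ab.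
rewrite !hornerE => E; exists c; first by rewrite in_itv in cab.
rewrite E !derivCE /=; congr (_ * _).
rewrite hornerMn hornerM sub0r hornerN hornerMn horner_exp hornerD hornerN !hornerXn hornerC.
rewrite exprMn -(mulr_natr (c ^+ n)) -(mulr_natr (- _ * _)).
by move: (c ^+ n) ((1 - _) ^+ n) (n.+1%:R) => P G N; ring.
Qed.

(** [F] is steepest at [t] by [hump_max], and [dF t] equals the right side: this is the matching of
    slopes with the line [y ^+ n.+1 + s * x = 1]. *)
Lemma dF_le (x : R) : 0 <= x <= 1 -> dF x <= s ^+ n.+1 * s.
Proof.
move=> /andP[x0 x1].
have h0 : 0 <= x * (1 - x ^+ n.+1) by rewrite mulr_ge0// subr_ge0 exprn_ile1.
have t0 := tpt_gt0; have w0 : 0 < 1 - tau by rewrite subr_gt0 tau_lt1.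
apply: (@le_trans _ _ (n.+1%:R ^+ 2 * (t * (1 - tau)) ^+ n)).
  by rewrite ler_wpM2l ?sqr_ge0// lerXn2r ?nnegrE ?hump_max// mulr_ge0// ltW.
(* This factor completes the powers to exponent [n.+1], where [tptX] and [slopeX] apply. *)
rewrite -(ler_pM2r (mulr_gt0 tau_gt0 (mulr_gt0 t0 w0))).
have -> : n.+1%:R ^+ 2 * (t * (1 - tau)) ^+ n * (tau * (t * (1 - tau))) =
          n.+1%:R ^+ 2 * tau * (t * (1 - tau)) ^+ n.+1 by rewrite [in RHS](exprS _ n);
            ring.
have -> : s ^+ n.+1 * s * (tau * (t * (1 - tau))) =
          (s ^+ n.+1 * tau) * (s * t) * (1 - tau) by ring.
rewrite slopeX slope_tpt exprMn tptX.
have -> : n.+1%:R ^+ 2 * tau * (tau * (1 - tau) ^+ n.+1) =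
  (n.+1%:R * tau) ^+ 2 * (1 - tau) ^+ n.+1 by ring.
by rewrite tau_mass expr2 mulrC mulrA.
Qed.

(** [F] is convex on [[t, 1]], because [dF] decreases there by [hump_le]. *)
Lemma F_tangent (a b : R) : t <= a <= 1 -> t <= b <= 1 ->
  F a - dF a * (b - a) <= F b.
Proof.
move=> /andP[ta a1] /andP[tb b1]; have t0 := ltW tpt_gt0.
have dF_anti (c d : R) : t <= c -> c <= d -> d <= 1 -> dF d <= dF c.
  move=> tc cd d1; have d0 : 0 <= d by lra.
  rewrite ler_wpM2l ?sqr_ge0// lerXn2r ?nnegrE ?mulr_ge0 ?hump_le ?subr_ge0//.
  - by rewrite exprn_ile1.
  - by lra.
  - by rewrite exprn_ile1//; lra.
have [ab|ba|->] := ltgtP a b; last by rewrite subrr mulr0 subr0.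
- have [c /andP[ac cb] E] := F_mvt ab.
  have : 0 <= (dF a - dF c) * (b - a).
    by rewrite mulr_ge0 ?subr_ge0 ?dF_anti ?(ltW ac) ?(ltW ab)//; lra.
  by lra.
- have [c /andP[bc ca] E] := F_mvt ba.
  have : 0 <= (dF c - dF a) * (a - b).
    by rewrite mulr_ge0 ?subr_ge0 ?dF_anti ?(ltW ca) ?(ltW ba)//; lra.
  by lra.
Qed.

Lemma F_tpt : F t = s ^+ n.+1 * tau.
Proof. by rewrite tptX slopeX. Qed.

(** Both sides agree at [t], and to its left [F] rises no faster than the line, by [dF_le]. *)
Lemma F_le_line (x : R) : 0 <= x <= t -> F x <= s ^+ n.+1 * (1 - s * x).
Proof.
move=> /andP[x0]; rewrite le_eqVlt => /orP[/eqP->|xt].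
  by rewrite F_tpt slope_tpt opprB addrC subrK.
have [c /andP[xc ct] E] := F_mvt xt.
have t1 := tpt_lt1.
have := @dF_le c; rewrite (_ : 0 <= c <= 1); last by lra.
move=> /(_ isT) /(ler_wpM2r (_ : 0 <= t - x)); rewrite subr_ge0 (ltW xt) => /(_ isT).
have : s ^+ n.+1 * s * t = s ^+ n.+1 * (1 - tau) by rewrite -mulrA slope_tpt.
by move: E; rewrite F_tpt; lra.
Qed.

(* On each side of the diagonal only one of the last two inequalities is active: the
   first, affine in [(x, y^(n+1))], for [x <= t], the second for [y <= t]. *)
Definition region (x y : R) : Prop :=
  [/\ 0 <= x <= 1, 0 <= y <= 1, 1 <= y ^+ n.+1 + s * x & 1 <= x ^+ n.+1 + s * y].

Lemma regionC (x y : R) : region x y -> region y x.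
Proof. by case=> *; split. Qed.

Lemma region01 : region 0 1.
Proof.
by split; rewrite ?lexx ?ler01 ?expr1n ?expr0n ?mulr0 ?mulr1 ?addr0 ?add0r ?slope_ge1.
Qed.

(** A tangent of the arc supports the whole region. Right of [t] this is convexity; left of [t] the
    region is above the line, and the tangent stays below it, being lower at [t] and no steeper. *)
Lemma region_tangent (x0 x y : R) : t <= x0 <= 1 -> region x y ->
  F x0 - dF x0 * (x - x0) <= s ^+ n.+1 * y ^+ n.+1.
Proof.
move=> x0t [/andP[x_ge0 x_le1] /andP[y_ge0 y_le1] h1 h2].
have t0 := tpt_gt0; have t1 := tpt_lt1; have s0 := slope_gt0.
have [tx|xt] := leP t x.
  apply: le_trans (F_tangent x0t _) _; first by rewrite tx x_le1.
  rewrite -exprMn lerXn2r ?nnegrE ?lerBlDl//.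
    by rewrite subr_ge0 exprn_ile1.
  by rewrite mulr_ge0 ?(ltW s0).
have S0 : 0 <= s ^+ n.+1 by rewrite exprn_ge0 ?ltW.
have : s ^+ n.+1 * (1 - s * x) <= s ^+ n.+1 * y ^+ n.+1 by rewrite ler_wpM2l//; lra.
apply: le_trans.
have := @F_tangent x0 t x0t; rewrite lexx (ltW t1) F_tpt => /(_ isT).
have := @dF_le x0; rewrite (_ : 0 <= x0 <= 1); last by lra.
move=> /(_ isT) /(ler_wpM2r (_ : 0 <= t - x)); rewrite subr_ge0 (ltW xt) => /(_ isT).
have : s ^+ n.+1 * s * t = s ^+ n.+1 * (1 - tau) by rewrite -mulrA slope_tpt.
lra.
Qed.

(** The first inequality is affine in [(x, y ^+ n.+1)], so it averages. The second reads
    [F x <= s ^+ n.+1 * y ^+ n.+1]: for [x <= t] it follows from the first, beyond [t] from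
    averaging the tangent at the mean [x]. *)
Lemma region_mean (p x1 y1 x2 y2 y : R) : 0 <= p <= 1 ->
  region x1 y1 -> region x2 y2 -> 0 <= y ->
  y ^+ n.+1 = p * y1 ^+ n.+1 + (1 - p) * y2 ^+ n.+1 ->
  region (p * x1 + (1 - p) * x2) y.
Proof.
move=> p01 K1 K2 y0 yE; set x := p * x1 + _.
have s0 := slope_gt0; have t0 := tpt_gt0.
have S0 : 0 < s ^+ n.+1 by rewrite exprn_gt0.
have mean (u v w : R) : w <= u -> w <= v -> w <= p * u + (1 - p) * v.
  by move: p01; clear; nra.
have mean' (u v w : R) : u <= w -> v <= w -> p * u + (1 - p) * v <= w.
  by move: p01; clear; nra.
case: (K1) => /andP[x10 x11] /andP[y10 y11] a1 b1.
case: (K2) => /andP[x20 x21] /andP[y20 y21] a2 b2.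
have x0 : 0 <= x by exact: mean.
have x1' : x <= 1 by exact: mean'.
have line : 1 <= y ^+ n.+1 + s * x.
  by have := mean _ _ _ a1 a2; rewrite yE /x; lra.
have Fy : F x <= s ^+ n.+1 * y ^+ n.+1.
  have [xt|tx] := leP x t.
    apply: le_trans (@F_le_line x _) _; first by rewrite x0 xt.
    by rewrite ler_pM2l//; lra.
  have xt : t <= x <= 1 by rewrite (ltW tx) x1'.
  have p0 : 0 <= p by case/andP: p01.
  have q0 : 0 <= 1 - p by case/andP: p01; rewrite subr_ge0.
  have := lerD (ler_wpM2l p0 (region_tangent xt K1))
    (ler_wpM2l q0 (region_tangent xt K2)).
  set D := dF x; set Fx := F x; set S := s ^+ n.+1; rewrite yE.
  have -> : p * (Fx - D * (x1 - x)) + (1 - p) * (Fx - D * (x2 - x)) = Fx.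
    by rewrite /x; ring.
  by rewrite [S * (_ + _)]mulrDr !(mulrCA S).
have yle1 : y <= 1.
  rewrite -(@ler_pXn2r _ n.+1)// ?nnegrE// expr1n yE.
  by apply: mean'; rewrite exprn_ile1.
split=> //; [by rewrite x0 x1'|by rewrite y0 yle1|].
rewrite -lerBlDl -(@ler_pXn2r _ n.+1)// ?nnegrE ?subr_ge0 ?exprn_ile1//.
- by rewrite exprMn.
- by rewrite mulr_ge0// ltW.
Qed.

(** With both coordinates below [t], [y ^+ n.+1 + s * x] would be less than [tau + (1 - tau)]. *)
Lemma region_tpt (x y r : R) : region x y -> x <= r -> y <= r -> t <= r.
Proof.
move=> [/andP[x0 _] /andP[y0 _] h _] xr yr; rewrite leNgt; apply/negP => rt.
have yt : y ^+ n.+1 <= tau.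
  by rewrite -tptX lerXn2r ?nnegrE ?(ltW tpt_gt0)//; lra.
have : s * x < s * t by rewrite ltr_pM2l ?slope_gt0//; lra.
by rewrite slope_tpt; lra.
Qed.

(** Here [a] belongs to the attacker who moves and [b] to the passive one, so [x] is a power mean
    and [y] an arithmetic mean, justified by [holder2]. *)
Lemma region_node (p : R) (a1 a0 b1 b0 : nat -> R) : 0 <= p <= 1 ->
  (forall i, 0 <= a1 i) -> (forall i, 0 <= a0 i) ->
  (forall i, 0 <= b1 i) -> (forall i, 0 <= b0 i) ->
  let dominated a b := exists x y : R, [/\ region x y,
    x ^+ n.+1 <= \prod_(i < n.+1) a i & y ^+ n.+1 <= \prod_(i < n.+1) b i] in
  (0 < p -> dominated a1 b1) -> (0 < 1 - p -> dominated a0 b0) ->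
  exists x y : R, [/\ region x y,
    x ^+ n.+1 <= p * \prod_(i < n.+1) a1 i + (1 - p) * \prod_(i < n.+1) a0 i &
    y ^+ n.+1 <= \prod_(i < n.+1) (p * b1 i + (1 - p) * b0 i)].
Proof.
move=> p01 a10 a00 b10 b00 dominated D1 D0.
(* A child of probability 0 comes with no domination hypothesis, but it also has no weight. *)
have [pE|p0] := eqVneq p 0.
  have [|x [y [K hx hy]]] := D0; first by rewrite pE subr0.
  exists x, y; split=> //; rewrite pE subr0 ?mul0r ?mul1r ?add0r//.
  by under eq_bigr do rewrite mul0r mul1r add0r.
have [pE|p1] := eqVneq p 1.
  have [|x [y [K hx hy]]] := D1; first by rewrite pE.
  exists x, y; split=> //; rewrite pE subrr ?mul0r ?mul1r ?addr0//.
  by under eq_bigr do rewrite mul0r mul1r addr0.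
case/andP: (p01) => p_ge0 p_le1.
have [|x1 [y1 [K1 hx1 hy1]]] := D1; first by rewrite lt_neqAle eq_sym p0.
have [|x0 [y0 [K0 hx0 hy0]]] := D0; first by rewrite subr_gt0 lt_neqAle p1.
have q_ge0 : 0 <= 1 - p by rewrite subr_ge0.
case: (K1) => /andP[x1_ge0 _] /andP[y1_ge0 _] _ _.
case: (K0) => /andP[x0_ge0 _] /andP[y0_ge0 _] _ _.
have [x x_ge0 xE] : exists2 x : R, 0 <= x &
    x ^+ n.+1 = p * x1 ^+ n.+1 + (1 - p) * x0 ^+ n.+1.
  by apply: nth_root_exists; rewrite addr_ge0// mulr_ge0// exprn_ge0.
exists x, (p * y1 + (1 - p) * y0); split.
- exact/regionC/(region_mean p01 (regionC K1) (regionC K0) x_ge0).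
- by rewrite xE lerD// ler_wpM2l.
- exact: holder2.
Qed.

End Region.

(** * Leaf masses and continuation values *)

Section Values.
Variables (R : realType) (m : nat).
Implicit Types (chi : seq bool -> bool) (q : seq bool -> R) (u : seq bool).

Definition edge q u (b : bool) : R := if b then q u else 1 - q u.

(* The value of the game from [u] with [d] messages left; unlike a quotient of
   masses it also makes sense at nodes that [q] reaches with probability 0. *)
Fixpoint cval chi q (d : nat) u : R :=
  if d is d'.+1 then
    q u * cval chi q d' (rcons u true) + (1 - q u) * cval chi q d' (rcons u false)
  else (chi u)%:R.

Definition stochastic q := forall u, (size u < m)%N -> 0 <= q u <= 1.

Lemma pathprob_rcons q u b : pathprob q (rcons u b) = pathprob q u * edge q u b.
Proof.
rewrite /pathprob size_rcons big_ord_recr /= nth_rcons ltnn eqxx.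
rewrite -cats1 take_size_cat//; congr (_ * _).
by apply: eq_bigr => i _; rewrite nth_cat ltn_ord take_cat ltn_ord.
Qed.

Lemma edge_ge0 q u b : stochastic q -> (size u < m)%N -> 0 <= edge q u b.
Proof. by move=> hq /hq; rewrite /edge; case: b; lra. Qed.

Lemma pathprob_ge0 q u : stochastic q -> (size u <= m)%N -> 0 <= pathprob q u.
Proof.
move=> hq; elim/last_ind: u => [|u b IH] hu; first by rewrite /pathprob big_ord0 ler01.
rewrite size_rcons in hu; rewrite pathprob_rcons mulr_ge0 ?edge_ge0//.
exact/IH/ltnW.
Qed.

Lemma leaf_ge0 q (t : m.-tuple bool) : stochastic q -> 0 <= pathprob q t.
Proof. by move=> /pathprob_ge0->; rewrite ?size_tuple. Qed.

Lemma massb_split chi b q u : (size u < m)%N ->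
  massb m chi b q u = massb m chi b q (rcons u true) + massb m chi b q (rcons u false).
Proof.
move=> hu; rewrite /massb (bigID (fun t : m.-tuple bool => nth false t (size u))) /=.
have E (c : bool) (t : m.-tuple bool) :
    prefix (rcons u c) t = prefix u t && (nth false t (size u) == c).
  by rewrite !prefixE size_rcons (take_nth false) ?size_tuple// eqseq_rcons.
congr (_ + _); apply: eq_bigl => t; rewrite E; case: (nth _ _ _);
  by rewrite ?andbT ?andbF.
Qed.

Lemma massb_leaf chi q u : size u = m -> massb m chi true q u = (chi u)%:R * pathprob q u.
Proof.
move=> hu; have {}hu : size u == m by apply/eqP.
rewrite /massb.
rewrite (eq_bigl (fun t => (t == Tuple hu) && chi u)); last first.
  move=> t; rewrite prefixE take_oversize ?size_tuple ?(eqP hu)// -val_eqE /=.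
  by case: eqP => //= ->; case: (chi u).
case: (chi u); rewrite ?mul1r ?mul0r.
  by under eq_bigl do rewrite andbT; rewrite big_pred1_eq.
by under eq_bigl do rewrite andbF; rewrite big_pred0_eq.
Qed.

(** Turns the ratios of masses in [bc_step] into ratios of values. *)
Lemma massbE chi q d u : (size u + d)%N = m ->
  massb m chi true q u = pathprob q u * cval chi q d u.
Proof.
elim: d u => [|d IH] u hu; first by rewrite massb_leaf 1?mulrC//; lia.
rewrite massb_split; last by lia.
rewrite !IH ?size_rcons; [|lia..].
by rewrite !pathprob_rcons /=; ring.
Qed.

Lemma pvalE chi q : pval m chi q = cval chi q m [::].
Proof.
rewrite -[RHS]mul1r -[X in X * _](_ : pathprob q [::] = 1);
  last by rewrite /pathprob big_ord0.
rewrite -massbE// /massb /pval; apply: eq_bigl => t.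
by rewrite prefix0s /= eqb_id.
Qed.

Lemma cval_bounds chi q d u : stochastic q -> (size u + d)%N = m ->
  0 <= cval chi q d u <= 1.
Proof.
move=> hq; elim: d u => [|d IH] u hu /=; first by case: (chi u); rewrite ?ler01 ?lexx.
have /hq : (size u < m)%N by lia.
have /IH : (size (rcons u true) + d)%N = m by rewrite size_rcons; lia.
have /IH : (size (rcons u false) + d)%N = m by rewrite size_rcons; lia.
nra.
Qed.

Lemma cval_negb chi q d u : cval (fun v => ~~ chi v) q d u = 1 - cval chi q d u.
Proof.
elim: d u => [|d IH] u /=; last by rewrite !IH; ring.
by case: (chi u); rewrite /= ?subrr ?subr0.
Qed.

Lemma massb_ge0 chi b q u : stochastic q -> 0 <= massb m chi b q u.
Proof. by move=> hq; apply: sumr_ge0 => t _; exact: leaf_ge0. Qed.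

Lemma bc_step_stochastic chi b q fb : stochastic q -> stochastic (bc_step m chi b q fb).
Proof.
move=> hq u hu; rewrite /bc_step; case: ifP => [h|_]; last by case: (fb u);
  rewrite ?ler01 ?lexx.
rewrite divr_ge0 ?massb_ge0//= ler_pdivrMr// mul1r (massb_split _ _ _ (u := u))// lerDl.
exact: massb_ge0.
Qed.

Lemma bc_step_edge chi b q fb u c : (size u < m)%N -> 0 < massb m chi b q u ->
  edge (bc_step m chi b q fb) u c = massb m chi b q (rcons u c) / massb m chi b q u.
Proof.
move=> hu h; rewrite /edge /bc_step h; case: c => //.
rewrite -[1](@divff _ (massb m chi b q u)) ?gt_eqF// -mulrBl; congr (_ / _).
by rewrite (massb_split _ _ _ (u := u))//; ring.
Qed.

End Values.

(** * The recursive attack of one party *)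

Section Attack.
Variables (R : realType) (m : nat) (ctrl : seq bool -> bool) (e : seq bool -> R).
Variables (chi : seq bool -> bool) (f : nat -> seq bool -> bool).
Hypothesis he : stochastic m e.
Implicit Types (u : seq bool) (i k d : nat).

Definition attacked i := joint ctrl (attA m ctrl e chi f i) e.
Definition aval i d u := cval chi (attacked i) d u.

Lemma attacked_stochastic i : stochastic m (attacked i).
Proof.
elim: i => [|i IH] u hu; rewrite /attacked /joint/=; case: (ctrl u); do ?exact: he.
exact: bc_step_stochastic.
Qed.

Lemma attacked0 : attacked 0 = e.
Proof. by apply: funext => u; rewrite /attacked /joint /=; case: ifP. Qed.

Lemma aval_step i d u : aval i d.+1 u =
  attacked i u * aval i d (rcons u true) + (1 - attacked i u) * aval i d (rcons u false).
Proof. by []. Qed.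

Lemma aval_bounds i d u : (size u + d)%N = m -> 0 <= aval i d u <= 1.
Proof. exact/cval_bounds/attacked_stochastic. Qed.

(** Induction on the level, then on the prefix: attacked edges towards [t] are positive because [t]
    carries mass one level below, and the other edges are honest. *)
Lemma leaf_reachable i (t : m.-tuple bool) j : chi t -> (j <= m)%N ->
  0 < pathprob e t -> 0 < pathprob (attacked i) (take j t).
Proof.
move=> chit + et.
have edge_e v b : (size v < m)%N -> prefix (rcons v b) t -> 0 < edge e v b.
  move=> hv /prefixP[w tE]; rewrite lt_neqAle (edge_ge0 _ he hv) andbT eq_sym.
  apply: contraTneq et => e0; rewrite tE cat_rcons -cat_rcons.
  suff -> : pathprob e (rcons v b ++ w) = 0 by rewrite ltxx.
  elim/last_ind: w {tE} => [|w c IH]; first by rewrite cats0 pathprob_rcons e0 mulr0.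
  by rewrite -rcons_cat pathprob_rcons IH mul0r.
elim: i j => [|i IHi]; elim=> [|j IHj] hj; rewrite ?take0 ?[pathprob _ [::]]big_ord0//.
- rewrite (take_nth false) ?size_tuple// pathprob_rcons mulr_gt0 ?(IHj (ltnW hj))//.
  rewrite attacked0 edge_e// ?size_take ?size_tuple ?hj//.
  by rewrite -take_nth ?size_tuple// prefix_take.
- have sz : size (take j t) = j by rewrite size_take size_tuple hj.
  rewrite (take_nth false) ?size_tuple// pathprob_rcons mulr_gt0 ?(IHj (ltnW hj))//.
  have pre : prefix (rcons (take j t) (nth false t j)) t.
    by rewrite -take_nth ?size_tuple// prefix_take.
  case hc : (ctrl (take j t)); last first.
    have := edge_e (take j t) _ _ pre; rewrite /edge /attacked /joint hc sz.
    by apply.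
  have mass0 v : prefix v t -> 0 < massb m chi true (attacked i) v.
    move=> hv; rewrite /massb (bigD1 t) ?hv ?chit//= ltr_pwDl//; last first.
      by apply: sumr_ge0 => t' _; exact: leaf_ge0 (attacked_stochastic i).
    by rewrite -{1}[X in pathprob _ X](take_size t) size_tuple IHi.
  have -> : edge (attacked i.+1) (take j t) (nth false t j) =
      edge (bc_step m chi true (attacked i) (f i)) (take j t) (nth false t j).
    by rewrite /edge /attacked /joint hc.
  by rewrite bc_step_edge ?sz// ?divr_gt0 ?mass0// prefix_take.
Qed.

(** Ensures that [bc_step] conditions, and does not fall back, wherever a leaf of outcome 1 is
    honestly reachable. *)
Lemma attack_mass_gt0 i u : (size u <= m)%N ->
  0 < massb m chi true e u -> 0 < massb m chi true (attacked i) u.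
Proof.
move=> hu h; have Qs := attacked_stochastic i.
have [t /andP[ut /eqP chit] et] : exists2 t : m.-tuple bool,
    prefix u t && (chi t == true) & 0 < pathprob e t.
  apply: contrapT => no; move: h; rewrite /massb big1 ?ltxx// => t ht.
  apply/eqP; rewrite eq_le (leaf_ge0 _ he) andbT leNgt.
  by apply/negP => et; apply: no; exists t.
rewrite /massb (bigD1 t) ?ut ?chit//= ltr_pwDl//.
  by rewrite -[X in pathprob _ X](take_size t) size_tuple leaf_reachable.
by apply: sumr_ge0 => t' _; exact: leaf_ge0 Qs.
Qed.

(** The reweighting rule: in the quotient of masses the probability of reaching [u] cancels. *)
Lemma attack_edge i d u b : (size u + d.+1)%N = m -> ctrl u ->
  0 < massb m chi true (attacked i) u ->
  edge (attacked i.+1) u b * aval i d.+1 u = edge (attacked i) u b * aval i d (rcons u b).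
Proof.
move=> hu cu h.
have -> : edge (attacked i.+1) u b = edge (bc_step m chi true (attacked i) (f i)) u b.
  by rewrite /edge /attacked /joint cu.
rewrite bc_step_edge//; last by lia.
move: h; rewrite (@massbE _ _ _ _ d.+1)// (@massbE _ _ _ _ d) ?size_rcons; last by lia.
rewrite pathprob_rcons -/(aval _ _ _) -/(aval _ _ _) => h.
have : pathprob (attacked i) u != 0 by apply: contraTneq h => ->; rewrite mul0r ltxx.
have : aval i d.+1 u != 0 by apply: contraTneq h => ->; rewrite mulr0 ltxx.
by move=> *; field; apply/andP.
Qed.

Lemma attacked_pass i u : ~~ ctrl u -> attacked i u = e u.
Proof. by rewrite /attacked /joint => /negbTE->. Qed.

Lemma attack_prod k d u : (size u + d.+1)%N = m -> ctrl u -> 0 < pathprob e u ->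
  \prod_(i < k.+1) aval i d.+1 u =
  e u * \prod_(i < k.+1) aval i d (rcons u true)
  + (1 - e u) * \prod_(i < k.+1) aval i d (rcons u false).
Proof.
move=> hu cu eu.
have V0 i b : 0 <= aval i d (rcons u b).
  by have /andP[] := @aval_bounds i d (rcons u b) ltac:(rewrite size_rcons; lia).
have /he /andP[e0 e1] : (size u < m)%N by lia.
(* With no mass of outcome 1 below [u] the fallback is arbitrary, but the factors of index 0 make
   both sides vanish. *)
have [h|h] := ltP 0 (massb m chi true e u); last first.
  have : aval 0 d.+1 u = 0.
    apply/eqP; rewrite eq_le; have /andP[-> _] := aval_bounds 0 hu.
    by move: h; rewrite (@massbE _ _ _ _ d.+1)// pmulr_rle0// andbT /aval attacked0.
  rewrite 3!big_ord_recl /= => H; rewrite H mul0r.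
  move: H; rewrite aval_step attacked0 => H.
  have [H1 H2] : e u * aval 0 d (rcons u true) = 0 /\ (1 - e u)
    * aval 0 d (rcons u false) = 0.
    have : 0 <= e u * aval 0 d (rcons u true) by rewrite mulr_ge0.
    have : 0 <= (1 - e u) * aval 0 d (rcons u false) by rewrite mulr_ge0// subr_ge0.
    lra.
  by rewrite !mulrA H1 H2 !mul0r addr0.
(* Telescoping: each level trades a factor at [u] for one at the child and lowers the level of the
   edge by one. *)
have step j b : edge (attacked j) u b * \prod_(i < j) aval i d.+1 u =
    edge e u b * \prod_(i < j) aval i d (rcons u b).
  elim: j => [|j IH]; first by rewrite !big_ord0 attacked0.
  rewrite !big_ord_recr /= mulrCA attack_edge//; last by apply: attack_mass_gt0 h; lia.
  by rewrite mulrCA mulrA IH mulrA.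
rewrite !big_ord_recr /= aval_step mulrDr !mulrA.
have /= := step k true; have /= := step k false; rewrite /edge => Ef Et.
by rewrite ![\prod_(i < k) aval i d.+1 u * _]mulrC Et Ef.
Qed.

(** At an attacker's node the new value times the old one is the mean of old times new child values;
    by induction it is at least the mean of the squared old values, hence the square of their
    mean. *)
Lemma attack_mono i d u : (size u + d)%N = m -> 0 < pathprob (attacked i) u ->
  aval i d u <= aval i.+1 d u.
Proof.
elim: d u => [|d IH] u hu pu; first exact: lexx.
have IHb b : 0 < edge (attacked i) u b -> aval i d (rcons u b) <= aval i.+1 d (rcons u b).
  by move=> hb; apply: IH; rewrite ?size_rcons ?pathprob_rcons ?mulr_gt0//; lia.
have edgeV b : edge (attacked i) u b * aval i d (rcons u b) <= edge (attacked i)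
  u b * aval i.+1 d (rcons u b).
  have : 0 <= edge (attacked i) u b by apply: (edge_ge0 (m := m));
    [exact: attacked_stochastic|lia].
  rewrite le_eqVlt => /orP[/eqP<-|hb]; first by rewrite !mul0r.
  by rewrite ler_pM2l ?IHb.
case hc : (ctrl u); last first.
  have := edgeV true; have := edgeV false.
  by rewrite /edge !aval_step !attacked_pass ?hc//; lra.
have [h|h] := ltP 0 (aval i d.+1 u); last first.
  by apply: le_trans h _; case/andP: (aval_bounds i.+1 hu).
have mass : 0 < massb m chi true (attacked i)
  u by rewrite (@massbE _ _ _ _ d.+1)// mulr_gt0.
have Et := attack_edge true hu hc mass; have Ef := attack_edge false hu hc mass.
have Vt : 0 <= aval i d (rcons u true).
  by have /andP[] := @aval_bounds i d (rcons u true) ltac:(rewrite size_rcons; lia).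
have Vf : 0 <= aval i d (rcons u false).
  by have /andP[] := @aval_bounds i d (rcons u false) ltac:(rewrite size_rcons; lia).
have /(attacked_stochastic i) : (size u < m)%N by lia.
have := ler_wpM2l Vt (edgeV true); have := ler_wpM2l Vf (edgeV false).
move: Et Ef; rewrite /edge => Et Ef eVf eVt /andP[q0 q1].
rewrite -(ler_pM2r h).
have -> : aval i.+1 d.+1 u * aval i d.+1 u =
    attacked i.+1 u * aval i d.+1 u * aval i.+1 d (rcons u true)
    + (1 - attacked i.+1 u) * aval i d.+1 u * aval i.+1 d (rcons u false).
  by rewrite (aval_step i.+1); ring.
rewrite Et Ef.
apply: (@le_trans _ _ (attacked i u * aval i d (rcons u true) * aval i d (rcons u true)
   + (1 - attacked i u) * aval i d (rcons u false) * aval i d (rcons u false)));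
     last by lra.
rewrite aval_step.
(* The variance of the old value over the two children. *)
have : 0 <= attacked i u * (1 - attacked i u) * (aval i d (rcons u true)
  - aval i d (rcons u false)) ^+ 2.
  by rewrite mulr_ge0 ?sqr_ge0// mulr_ge0// subr_ge0.
nra.
Qed.

Lemma attack_root_mono i j : (i <= j)%N -> aval i m [::] <= aval j m [::].
Proof.
elim: j => [|j IH]; first by rewrite leqn0 => /eqP->.
rewrite leq_eqVlt => /orP[/eqP->//|/IH h]; apply: le_trans h _.
by apply: attack_mono => //; rewrite /pathprob big_ord0.
Qed.

End Attack.

(** * Exchanging the two parties *)

Section Duality.
Variables (R : realType) (m : nat) (ctrl : seq bool -> bool) (e : seq bool -> R).
Variables (chi : seq bool -> bool) (f : nat -> seq bool -> bool).
Let nctrl u := ~~ ctrl u.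
Let nchi u := ~~ chi u.

Lemma jointC (sA sB : seq bool -> R) : joint ctrl sA sB = joint nctrl sB sA.
Proof. by apply: funext => u; rewrite /joint /nctrl; case: (ctrl u). Qed.

Lemma bc_step_negb q fb : bc_step (R := R) m chi false q fb = bc_step m nchi true q fb.
Proof.
have E u : massb (R := R) m chi false q u = massb m nchi true q u.
  by apply: eq_bigl => t; rewrite /nchi; case: (chi t).
by apply: funext => u; rewrite /bc_step !E.
Qed.

(** Swapping control and negating outcomes makes the attack of B towards 0 an attack of A towards 1,
    so the results on [attA] cover both. *)
Lemma attB_dual i : attB m ctrl e chi f i = attA m nctrl e nchi f i.
Proof. by elim: i => //= i ->; rewrite bc_step_negb jointC. Qed.

Lemma pval_attB i :
  pval m chi (joint ctrl e (attB m ctrl e chi f i)) =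
  1 - aval m nctrl e nchi f i m [::].
Proof. by rewrite attB_dual jointC pvalE /aval cval_negb subKr. Qed.

End Duality.

(** * The invariant along the game tree *)

Section Dominated.
Variables (R : realType) (n m : nat) (e : seq bool -> R).
Hypothesis he : stochastic m e.

(** Only a minorant of the [n.+1]-th roots is asked to lie in [region], since Hölder gives just a
    lower bound. *)
Definition dominated (P1 P2 : nat -> R) := exists x y : R,
  [/\ region n x y, x ^+ n.+1 <= \prod_(i < n.+1) P1 i
                  & y ^+ n.+1 <= \prod_(i < n.+1) P2 i].

Lemma dominatedC P1 P2 : dominated P1 P2 -> dominated P2 P1.
Proof. by case=> x [y [/regionC K hx hy]]; exists y, x. Qed.

(** Two unrelated control schemes and outputs are allowed, so that nodes of either party are served,
    up to [dominatedC]. *)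
Lemma dominated_node ctrl1 chi1 f1 ctrl2 chi2 f2 d u :
  let v1 u i := aval m ctrl1 e chi1 f1 i d u in
  let v2 u i := aval m ctrl2 e chi2 f2 i d u in
  (size u + d.+1)%N = m -> 0 < pathprob e u -> ctrl1 u -> ~~ ctrl2 u ->
  (forall b, 0 < edge e u b -> dominated (v1 (rcons u b)) (v2 (rcons u b))) ->
  dominated (fun i => aval m ctrl1 e chi1 f1 i d.+1 u)
            (fun i => aval m ctrl2 e chi2 f2 i d.+1 u).
Proof.
move=> v1 v2 hu pu c1 c2 IH.
have sz b : (size (rcons u b) + d)%N = m by rewrite size_rcons; lia.
have v1_ge0 b i : 0 <= v1 (rcons u b) i by case/andP: (aval_bounds ctrl1 chi1 f1 he i (sz b)).
have v2_ge0 b i : 0 <= v2 (rcons u b) i by case/andP: (aval_bounds ctrl2 chi2 f2 he i (sz b)).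
have eu : 0 <= e u <= 1 by apply: he; lia.
have [x [y [K hx hy]]] := region_node eu (v1_ge0 true) (v1_ge0 false)
  (v2_ge0 true) (v2_ge0 false) (IH true) (IH false).
exists x, y; split=> //; first by rewrite attack_prod.
under eq_bigr do rewrite aval_step attacked_pass//.
exact: hy.
Qed.

Lemma dominated_attacks ctrl chi fA fB d u :
  (size u + d)%N = m -> 0 < pathprob e u ->
  dominated (fun i => aval m ctrl e chi fA i d u)
    (fun i => aval m (fun v => ~~ ctrl v) e (fun v => ~~ chi v) fB i d u).
Proof.
elim: d u => [|d IH] u hu pu.
  (* At a leaf all levels have the same value, 0 or 1, and the two products are complementary. *)
  rewrite /dominated /aval /=; case: (chi u).
    by exists 1, 0; split; [exact/regionC/region01|rewrite prodr_const card_ord..].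
  by exists 0, 1; split; [exact/region01|rewrite prodr_const card_ord..].
have IHb b : 0 < edge e u b -> dominated (fun i => aval m ctrl e chi fA i d (rcons u b))
    (fun i => aval m (fun v => ~~ ctrl v) e (fun v => ~~ chi v) fB i d (rcons u b)).
  by move=> eb; apply: IH; rewrite ?size_rcons ?pathprob_rcons ?mulr_gt0//; lia.
have [cu|cu] := boolP (ctrl u).
  by apply: dominated_node; rewrite ?cu.
apply/dominatedC/dominated_node => // b eb.
exact/dominatedC/IHb.
Qed.

End Dominated.

(** * Choice of the recursion depth and conclusion *)

Lemma rounds_suffice (R : realType) (eps : R) : 0 < eps <= 2^-1 ->
  exists2 n : nat, n%:R <= 4 * eps^-1 * ln eps^-1 & (1 - eps) ^+ n.+1 < tau n.
Proof.
move=> /andP[e0 e2]; set L := ln eps^-1.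
have epsV : 0 < eps^-1 by rewrite invr_gt0.
have L0 : 0 <= L by rewrite ln_ge0// invf_ge1//; lra.
have LE : L <= eps^-1 - 1.
  have := @le_ln1Dx R (eps^-1 - 1); rewrite addrCA subrr addr0; apply; lra.
have /truncn_itv/andP[n1 n2] : 0 <= 4 * eps^-1 * L by rewrite !mulr_ge0// ltW.
exists (Num.truncn (4 * eps^-1 * L)) => //; move: (Num.truncn _) n1 n2 => n n1 n2.
(* Uses [1 - eps <= expR (- eps)] and [n.+1 > 4 * eps^-1 * L]. The exponent 4 suffices because
   [n.+2] is only of order [eps ^- 2], by [LE]. *)
have pow : (1 - eps) ^+ n.+1 <= eps ^+ 4.
  apply: (@le_trans _ _ (expR (- eps) ^+ n.+1)).
    by rewrite lerXn2r ?nnegrE ?expR_ge0 ?expR_ge1Dx//; lra.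
  have -> : eps ^+ 4 = expR (4%:R * - L).
    by rewrite expRM_natl /L lnV ?posrE// opprK lnK ?posrE.
  rewrite -expRM_natl ler_expR !mulrN lerN2 -ler_pdivrMr//.
  by rewrite mulrAC ltW.
apply: le_lt_trans pow _; rewrite -[tau n]mul1r ltr_pdivlMr ?ltr0n//.
have nE : n.+2%:R * eps ^+ 2 <= 4 - 4 * eps + 2 * eps ^+ 2.
  have : n.+2%:R <= 4 * eps^-1 * (eps^-1 - 1) + 2.
    rewrite -addn2 natrD lerD2r; apply: le_trans n1 _.
    by rewrite ler_pM2l// mulr_gt0.
  move=> /(ler_wpM2r (sqr_ge0 eps))/le_trans; apply.
  by rewrite le_eqVlt; apply/orP; left; apply/eqP; field; rewrite gt_eqF.
have := ler_wpM2l (sqr_ge0 eps) nE.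
have : eps ^+ 2 * (4 - 4 * eps + 2 * eps ^+ 2) < 1 by nra.
rewrite (exprD eps 2 2) -mulrA (mulrC _ n.+2%:R); lra.
Qed.

Theorem theorem3p3 (R : realType) :
  exists (C : R) (d : nat),
  forall eps : R, 0 < eps <= 2^-1 ->
  exists kappa : nat,
    kappa%:R <= C * eps^-1 * (ln (eps^-1)) ^+ d /\
    forall (m : nat) (ctrl : seq bool -> bool) (e : seq bool -> R)
           (chi : seq bool -> bool),
      (forall u : seq bool, (size u < m)%N -> 0 <= e u <= 1) ->
      forall fA fB : nat -> seq bool -> bool,
        1 - eps < pval m chi (joint ctrl (attA m ctrl e chi fA kappa) e) \/
        pval m chi (joint ctrl e (attB m ctrl e chi fB kappa)) < eps.
Proof.
exists 4, 1 => eps heps.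
have [n n_le n_big] := rounds_suffice heps.
have e1 : 0 <= 1 - eps by move: heps; lra.
exists n; split; first by rewrite expr1.
move=> m ctrl e chi he fA fB.
(* If level [n] misses its target, so do all lower levels by monotonicity, and every factor is at
   most [1 - eps]. *)
have prod_le ctrl' chi' f (x : R) : 0 <= x ->
    aval m ctrl' e chi' f n m [::] <= 1 - eps ->
    x ^+ n.+1 <= \prod_(i < n.+1) aval m ctrl' e chi' f i m [::] -> x <= 1 - eps.
  move=> x0 hn hx; rewrite -(@ler_pXn2r _ n.+1)// ?nnegrE//.
  apply: le_trans hx _; rewrite -[in leRHS](card_ord n.+1) -prodr_const.
  apply: ler_prod => i _; have /andP[-> _] /= :=
    aval_bounds ctrl' chi' f he i (erefl : (size [::] + m)%N = m).
  by apply: le_trans hn; apply: attack_root_mono; rewrite // -ltnS.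
have pvA : pval m chi (joint ctrl (attA m ctrl e chi fA n) e)
  = aval m ctrl e chi fA n m [::].
  by rewrite pvalE.
rewrite pvA pval_attB.
case: ltP => [_|hA]; [by left|right].
rewrite ltNge; apply/negP => hB.
have [||x [y [K hx hy]]] := @dominated_attacks R n m e he ctrl chi fA fB m [::].
- by [].
- by rewrite /pathprob big_ord0.
case: (K) => /andP[x0 _] /andP[y0 _] _ _.
have xe := prod_le _ _ _ _ x0 hA hx.
have ye : y <= 1 - eps by apply: prod_le hy => //; lra.
(* Both coordinates are at most [1 - eps], so the diagonal point [t] is too, against the choice of
   [n]. *)
have t_le := region_tpt K xe ye.
have : tau n <= (1 - eps) ^+ n.+1.
  by rewrite -tptX lerXn2r ?nnegrE ?(ltW (tpt_gt0 _ _)).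
by rewrite leNgt n_big.
Qed.
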